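(* A graph $G\in\mathcal{P}$ is double mirror symmetric if and only if $G$ has a one-point orbit of the form $\{(k,k,0)\}$ or $\{(k,3k,k)\}$ for some $k\in\mathbb{N}$ (positive integer).
   Context: Graphs are finite and loopless but may have multiple edges. A plane triangulation is a plane graph all of whose faces (including the outer one) are bounded by cycles of length 3. $\mathcal{P}$ is the family of all 2-connected plane triangulations all of whose vertices have degree 3 or 6. $Q=\{0,1,2\}$ is the cyclic group of integers modulo 3. For $P\in\mathcal{P}$ fix a partition of the edge set into three classes indexed by $Q$ such that for every vertex $v$, if two edges are counterclockwise successive edges incident with $v$, then the first is of class $q$ and the second is of class $q+1$ for some $q\in Q$ (such a partition is known to exist, by Grünbaum and Motzkin). A subgraph is of class $q$ if all of its edges are of class $q$. It is known that the spanning subgraph $P_q$ formed by the edges of class $q$ consists of two induced paths (the maximal paths of class $q$, whose ends are the four vertices of degree 3) of the same length, denoted $M(q)$, and of $K(q)-1$ induced cycles of the same length $2M(q)$, where $K(q)$ is the distance in $P$ between the two maximal paths of class $q$. For a vertex $A$ of degree 3, $[A,q]$ denotes the maximal path of class $q$ having $A$ as an end, oriented as $v_0v_1\ldots v_{M(q)}$ with initial vertex $A=v_0$ and terminal vertex $A_q=v_{M(q)}$. An edge is adjacent to a path if it does not belong to the path but is incident with a vertex of it. An edge $e$ adjacent to $[A,q]$ at the vertex $v_j$ is a left branch of $[A,q]$ if either $0\le j<M(q)$ and $v_jv_{j+1},e$ are counterclockwise successive edges at $v_j$, or $0<j\le M(q)$ and $e,v_{j-1}v_j$ are counterclockwise successive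 edges at $v_j$; otherwise it is a right branch. Put $[A,q](e)=j$ if $e$ is a left branch and $[A,q](e)=2M(q)-j$ if $e$ is a right branch. Let $A,C$ be ends of the two different maximal paths of class $q$. Let $f$ (respectively $g$) be the first edge of the oriented path $[C,q+1]$ (respectively $[C,q-1]$) which is adjacent to $[A,q]$. Then $S^+(q)=[A,q](f)$ if $f$ is a left branch of $[A,q]$ and $S^+(q)=[A,q](f)-M(q)$ if $f$ is a right branch; $S^-(q)=[A,q](g)$ if $g$ is a left branch of $[A,q]$ and $S^-(q)=[A,q](g)-M(q)$ if $g$ is a right branch. These values do not depend on the choice of $A$ and $C$, and $0\le S^+(q)<M(q)$, $0<S^-(q)\le M(q)$. The orbit of $P$ is the set $\{(K(q),M(q),S^+(q)):q\in Q\}$. The graph $P$ is double mirror symmetric if there exist two distinct elements $q_1,q_2\in Q$ such that $S^+(q_i)=M(q_i)-S^-(q_i)$ for $i=1,2$. *)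

(* Defs.v *)
From HB Require Import structures.
From mathcomp Require Import all_boot all_order all_algebra all_fingroup.

Set Implicit Arguments.
Unset Strict Implicit.
Unset Printing Implicit Defensive.

(* Embedded graphs are given by rotation systems.  Each edge is split into two
   darts, one at each end, exchanged by [opp]; [rot d] is the next dart
   counterclockwise around the vertex carrying [d].  Vertices, edges and faces
   are the orbits of [rot], [opp] and [face_perm].  Multiple edges and loops
   are both possible a priori. *)
Record rotation_system := RotationSystem {
  dart : finType;
  rot : {perm dart};
  opp : {perm dart};
  oppK : involutive opp;
  opp_neq : forall d, opp d != d
}.

Definition tail (G : rotation_system) (d : dart G) : {set dart G} :=
  porbit (rot G) d.

Definition head (G : rotation_system) (d : dart G) : {set dart G} :=
  tail (opp G d).

Definition vertices (G : rotation_system) : {set {set dart G}} :=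
  porbits (rot G).

Definition degree (G : rotation_system) (v : {set dart G}) : nat := #|v|.

(* [face_perm G d] follows [d] on the boundary of the face to the left of [d]:
   it is [(rot G)^-1 (opp G d)]. *)
Definition face_perm (G : rotation_system) : {perm dart G} :=
  (opp G * (rot G)^-1)%g.

Definition adj (G : rotation_system) : rel {set dart G} :=
  [rel u v | [exists d, (tail d == u) && (head d == v)]].

Definition connected (G : rotation_system) : Prop :=
  {in vertices G &, forall u v, connect (@adj G) u v}.

Definition two_connected (G : rotation_system) : Prop :=
  [/\ 2 < #|vertices G|, connected G &
      forall x u v, x \in vertices G -> u \in vertices G -> v \in vertices G ->
        u != x -> v != x ->
        connect [rel a b | [&& adj a b, a != x & b != x]] u v].

Definition loopless (G : rotation_system) : Prop :=
  forall d : dart G, head d != tail d.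

(* A connected rotation system describes an embedding in the sphere,
   equivalently a plane graph, exactly when V - E + F = 2. *)
Definition plane (G : rotation_system) : Prop :=
  connected G /\
  #|porbits (rot G)| + #|porbits (face_perm G)| = #|porbits (opp G)| + 2.

Definition triangulation (G : rotation_system) : Prop :=
  forall d : dart G, #|porbit (face_perm G) d| = 3 /\
    {in porbit (face_perm G) d &, injective (@tail G)}.

Definition in_P (G : rotation_system) : Prop :=
  [/\ loopless G, plane G, triangulation G, two_connected G &
      forall v, v \in vertices G -> degree v = 3 \/ degree v = 6].

Definition class_partition (G : rotation_system) (c : dart G -> 'Z_3) : Prop :=
  forall d, c (opp G d) = c d /\ c (rot G d) = (c d + 1)%R.

(* A path is given by its initial vertex [A] and the sequence [p] of its darts,
   each directed forward; [verts A p] is its sequence of vertices. *)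
Definition verts (G : rotation_system) (A : {set dart G}) (p : seq (dart G)) :
    seq {set dart G} :=
  A :: [seq head d | d <- p].

Definition edges (G : rotation_system) (p : seq (dart G)) : {set dart G} :=
  [set d | (d \in p) || (opp G d \in p)].

Definition class_path (G : rotation_system) (c : dart G -> 'Z_3) (q : 'Z_3)
    (A : {set dart G}) (p : seq (dart G)) : bool :=
  [&& A \in vertices G,
      [seq tail d | d <- p] == belast A [seq head d | d <- p],
      all [pred d | c d == q] p & uniq (verts A p)].

Definition subpath (G : rotation_system) (A : {set dart G}) (p : seq (dart G))
    (B : {set dart G}) (r : seq (dart G)) : bool :=
  all [in verts B r] (verts A p) && (edges p \subset edges r).

(* Paths have distinct vertices, hence fewer darts than [dart G], so bounding
   the length of [r] loses nothing. *)
Definition max_class_path (G : rotation_system) (c : dart G -> 'Z_3) (q : 'Z_3)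
    (A : {set dart G}) (p : seq (dart G)) : bool :=
  class_path c q A p &&
  [forall B : {set dart G}, forall r : {bseq #|dart G| of dart G},
     class_path c q B r && subpath A p B r ==> subpath B r A p].

(* The path [A,q] *)
Definition maxpath (G : rotation_system) (c : dart G -> 'Z_3)
    (A : {set dart G}) (q : 'Z_3) : seq (dart G) :=
  if [pick p : {bseq #|dart G| of dart G} | max_class_path c q A p] is Some p
  then p else [::].

Definition maxpath_verts (G : rotation_system) (c : dart G -> 'Z_3)
    (A : {set dart G}) (q : 'Z_3) : seq {set dart G} :=
  verts A (maxpath c A q).

Definition ends_of_distinct_maxpaths (G : rotation_system)
    (c : dart G -> 'Z_3) (q : 'Z_3) (A C : {set dart G}) : bool :=
  [&& A \in vertices G, degree A == 3, C \in vertices G, degree C == 3 &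
      edges (maxpath c A q) != edges (maxpath c C q)].

(* A choice of ends A, C of the two maximal paths of class q.  The quantities
   below do not depend on it. *)
Definition chosen_ends (G : rotation_system) (c : dart G -> 'Z_3) (q : 'Z_3) :
    {set dart G} * {set dart G} :=
  odflt (set0, set0)
    [pick AC : {set dart G} * {set dart G} |
       ends_of_distinct_maxpaths c q AC.1 AC.2].

Definition walk_between (G : rotation_system) (U W : seq {set dart G})
    (n : nat) : bool :=
  [exists u in U, exists t : n.-tuple {set dart G},
     path (@adj G) u t && (last u t \in W)].

(* The least length of a walk from U to W; in a connected graph it is smaller
   than the number of vertices, hence than the number of darts. *)
Definition distance (G : rotation_system) (U W : seq {set dart G}) : nat :=
  find (walk_between U W) (iota 0 #|dart G|).

Definition M (G : rotation_system) (c : dart G -> 'Z_3) (q : 'Z_3) : nat :=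
  size (maxpath c (chosen_ends c q).1 q).

Definition K (G : rotation_system) (c : dart G -> 'Z_3) (q : 'Z_3) : nat :=
  distance (maxpath_verts c (chosen_ends c q).1 q)
           (maxpath_verts c (chosen_ends c q).2 q).

Definition adjacent (G : rotation_system) (A : {set dart G})
    (p : seq (dart G)) (d : dart G) : bool :=
  (d \notin edges p) && ((tail d \in verts A p) || (head d \in verts A p)).

(* The edge adjacent to the path at its j-th vertex is represented by its dart
   [e] at that vertex.  The [j]-th dart of [p] is the dart of v_j v_(j+1) at
   v_j, and [opp] of the preceding one is the dart of v_(j-1) v_j at v_j. *)
Definition left_branch (G : rotation_system) (p : seq (dart G)) (j : nat)
    (e : dart G) : bool :=
  ((j < size p) && (e == rot G (nth e p j))) ||
  ((0 < j <= size p) && (opp G (nth e p j.-1) == rot G e)).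

(* The number [A,q](e), where p is [A,q] and e is adjacent at its j-th vertex *)
Definition branch_position (G : rotation_system) (p : seq (dart G)) (j : nat)
    (e : dart G) : nat :=
  if left_branch p j e then j else 2 * size p - j.

(* The dart of the edge of [d] at the path; as maximal paths are induced, an
   adjacent edge has only one end on the path. *)
Definition dart_at (G : rotation_system) (A : {set dart G})
    (p : seq (dart G)) (d : dart G) : dart G :=
  if tail d \in verts A p then d else opp G d.

(* Common part of S^+(q) (r = q + 1) and S^-(q) (r = q - 1).  The subtraction
   is never truncated, because j <= size p. *)
Definition S_at (G : rotation_system) (c : dart G -> 'Z_3) (q r : 'Z_3)
    (A C : {set dart G}) : nat :=
  let p := maxpath c A q in
  if [seq d <- maxpath c C r | adjacent A p d] is f :: _ then
    let e := dart_at A p f in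
    let j := index (tail e) (verts A p) in
    if left_branch p j e then branch_position p j e
    else branch_position p j e - size p
  else 0.

Definition Splus (G : rotation_system) (c : dart G -> 'Z_3) (q : 'Z_3) : nat :=
  S_at c q (q + 1)%R (chosen_ends c q).1 (chosen_ends c q).2.

Definition Sminus (G : rotation_system) (c : dart G -> 'Z_3) (q : 'Z_3) : nat :=
  S_at c q (q - 1)%R (chosen_ends c q).1 (chosen_ends c q).2.

(* The orbit, as a sequence to be compared up to [=i]. *)
Definition orbit_of (G : rotation_system) (c : dart G -> 'Z_3) :
    seq (nat * nat * nat) :=
  [seq (K c q, M c q, Splus c q) | q : 'Z_3].

(* Subtraction is not truncated here either, since S^-(q) <= M(q). *)
Definition double_mirror_symmetric (G : rotation_system)
    (c : dart G -> 'Z_3) : Prop :=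
  exists q1 q2 : 'Z_3, [/\ q1 != q2,
    Splus c q1 = M c q1 - Sminus c q1 & Splus c q2 = M c q2 - Sminus c q2].

(* Main.v *)
(* Let [move x y] translate a dart of G by x steps in its own direction and y
   steps in the direction 60 degrees to its left, as in the triangular lattice,
   with the convention that a straight walk through a vertex of degree 3 turns
   back.  Since faces are triangles and degrees divide 6, these translations
   commute, so Z^2 acts transitively on the directed edges of each class, up to
   reversal.  By Euler's formula there are four vertices of degree 3, so the
   stabiliser of a dart is 2L, with L the lattice of the positions of these
   vertices.  In other words, G is the quotient of the triangular lattice by the
   half-turns around the points of L.

   In the basis given by the directions of class q and q + 1, L is spanned by
   (M(q), 0) and (S^+(q), K(q)), and S^-(q) is congruent to S^+(q) + K(q) modulo
   M(q).  The equation S^+(q) = M(q) - S^-(q) thus says that M(q) divides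
   2 S^+(q) + K(q), that is, that L is symmetric in the axis of direction q.  Two
   such symmetries generate a rotation of order 3, which makes the three
   parameter triples equal, with S^+ = t K, M = n K, n | 2t + 1 and
   n | t^2 + t + 1; so n divides 3. *)
Require Import Defs.
From mathcomp Require Import all_boot all_order all_algebra all_fingroup.
From mathcomp Require Import zify ring.

Set Implicit Arguments.
Unset Strict Implicit.
Unset Printing Implicit Defensive.

Import Defs GRing.Theory.

(* Direct injection on these tuples would try to evaluate [K], [M] and [Splus]. *)
Lemma triple_inj (T : Type) (a b c a' b' c' : T) :
  (a, b, c) = (a', b', c') -> [/\ a = a', b = b' & c = c'].
Proof. by case=> -> -> ->. Qed.

Lemma Z3_cases (q r : 'Z_3) : r = q \/ r = (q + 1)%R \/ r = (q + 1 + 1)%R.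
Proof.
case: q r => [[|[|[|]]]] // i [[|[|[|]]]] // j;
  by [left; apply: val_inj|right; left; apply: val_inj|right; right; apply: val_inj].
Qed.

(** * Orbit counts and bounded search *)

Lemma sum_porbits (T : finType) (s : {perm T}) :
  \sum_(v in porbits s) #|v| = #|T|.
Proof.
rewrite -sum1_card (partition_big (porbit s) (mem (porbits s))) /=; last first.
  by move=> x _; exact: imset_f.
apply: eq_bigr => v /imsetP[x _ ->]; rewrite -sum1_card; apply: eq_bigl => y.
by rewrite eq_porbit_mem.
Qed.

Lemma card_uniform_porbits (T : finType) (s : {perm T}) n :
  (forall x, #|porbit s x| = n) -> #|porbits s| * n = #|T|.
Proof.
move=> h; rewrite -(sum_porbits s) -sum_nat_const.
by apply: eq_bigr => v /imsetP[x _ ->].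
Qed.

Lemma find_iota (a : pred nat) n N : n < N -> a n -> (forall i, i < n -> ~~ a i) ->
  find a (iota 0 N) = n.
Proof.
move=> nN an hn; have N_iota : n \in iota 0 N by rewrite mem_iota.
have ha : has a (iota 0 N) by apply/hasP; exists n.
have := nth_find 0 ha; have := ha; rewrite has_find size_iota => fN.
rewrite nth_iota // add0n => af; apply/eqP; rewrite eqn_leq; apply/andP; split.
  rewrite leqNgt; apply/negP => /(before_find 0).
  by rewrite nth_iota // add0n an.
by rewrite leqNgt; apply/negP => /hn; rewrite af.
Qed.

(** * Powers with integer exponents *)

Section IntegerPowers.
Local Open Scope group_scope.
Variable gT : finGroupType.
Implicit Types (g h : gT) (m n : int).

Definition expgz g m : gT :=
  match m with Posz n => g ^+ n | Negz n => g ^- n.+1 end.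

Lemma expgzS g m : expgz g (m + 1)%R = expgz g m * g.
Proof.
case: m => [n|[|n]].
- have -> : (Posz n + 1)%R = Posz n.+1 by lia.
  by rewrite /= expgSr.
- by rewrite /= expg1 mulVg.
- have -> : (Negz n.+1 + 1)%R = Negz n by lia.
  by rewrite /= [in RHS]expgS invMg mulgKV.
Qed.

Lemma expgzD g m n : expgz g (m + n)%R = expgz g m * expgz g n.
Proof.
elim/int_ind: n => [|n IH|n IH]; first by rewrite addr0 mulg1.
  by rewrite -addn1 PoszD addrA !expgzS IH mulgA.
apply: (mulIg g); rewrite -mulgA -!expgzS.
have -> : (m - n.+1%:Z + 1 = m - n%:Z)%R by lia.
by have -> : (- n.+1%:Z + 1 = - n%:Z)%R by lia.
Qed.

Lemma expgzN g m : expgz g (- m)%R = (expgz g m)^-1.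
Proof. by apply/eqP; rewrite eq_sym eq_invg_mul -expgzD subrr. Qed.

Lemma commute_expgz g h m : commute g h -> commute g (expgz h m).
Proof.
by move=> gh; case: m => n /=; [apply: commuteX|apply/commuteV/commuteX].
Qed.

Lemma commute_expgz2 g h m n : commute g h -> commute (expgz g m) (expgz h n).
Proof. by move=> gh; apply/commute_expgz/commute_sym/commute_expgz/commute_sym. Qed.

Lemma expgz_conj g h k m : g * h = k * g -> g * expgz h m = expgz k m * g.
Proof.
move=> ghk; have -> : k = h ^ g^-1 by rewrite conjgE invgK mulgA ghk mulgK.
have -> : expgz (h ^ g^-1) m = expgz h m ^ g^-1.
  by case: m => n /=; rewrite ?conjVg conjXg.
by rewrite conjgE invgK !mulgA mulgKV.
Qed.

Lemma expgz_prod g h m : commute g h -> expgz (g * h) m = expgz g m * expgz h m.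
Proof.
move=> gh; case: m => n /=; rewrite expgMn // invMg.
exact/commuteV/commute_sym/commuteV/commuteX2/commute_sym.
Qed.

End IntegerPowers.

(** * Plane lattices in Hermite normal form *)

Section Hermite.
Local Open Scope ring_scope.

Lemma int_ideal (I : int -> bool) (n : nat) : (0 < n)%N -> I n ->
  (forall x y, I x -> I y -> I (x - y)) ->
  exists2 m : nat, (0 < m)%N & forall x, I x <-> exists u, x = u * m%:Z.
Proof.
move=> n_gt0 In IB.
have I0 : I 0 by rewrite -(subrr n%:Z) IB.
have IN x : I x -> I (- x) by move=> Ix; rewrite -sub0r IB.
have IM x u : I x -> I (u * x).
  move=> Ix; elim/int_ind: u => [|u IH|u IH]; first by rewrite mul0r.
  - have -> : u.+1%:Z * x = u%:Z * x - (- x) by lia.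
    by rewrite IB ?IN.
  - have -> : - u.+1%:Z * x = - u%:Z * x - x by lia.
    by rewrite IB.
have exm : exists m, (0 < m)%N && I m by exists n; rewrite n_gt0.
case: (ex_minnP exm) => m /andP[m_gt0 Im] mmin; exists m => // x.
split=> [Ix|[u ->]]; last exact: IM.
exists (x %/ m)%Z; have E := divz_eq x m.
have Ir : I (x %% m)%Z.
  have -> : (x %% m)%Z = x - (x %/ m)%Z * m by lia.
  by rewrite IB // IM.
have r0 : 0 <= (x %% m)%Z by apply: modz_ge0; lia.
have rm : (x %% m)%Z < m by apply: ltz_pmod; lia.
case: (x %% m)%Z Ir r0 rm E => // r Ir _ rm E.
case: r Ir rm E => [|r] Ir rm E; first by lia.
have := mmin r.+1; rewrite Ir /=; lia.
Qed.

(** [K] generates the ideal of second coordinates, [M] that of the first coordinates of points on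
    the axis, and [s] is the first coordinate of some point at height [K]. *)
Lemma hermite_normal_form (L : int -> int -> bool) (n : nat) : (0 < n)%N ->
  L n 0 -> L 0 n ->
  (forall x y x' y', L x y -> L x' y' -> L (x - x') (y - y')) ->
  exists M K : nat, exists s : int, [/\ (0 < M)%N, (0 < K)%N &
    forall x y, L x y <-> exists u v, x = u * M%:Z + v * s /\ y = v * K%:Z].
Proof.
move=> n_gt0 Ln0 L0n LB.
have L00 : L 0 0 by have := LB _ _ _ _ Ln0 Ln0; rewrite !subrr.
have LN x y : L x y -> L (- x) (- y).
  by move=> Lxy; rewrite -(sub0r x) -(sub0r y) LB.
have LD x y x' y' : L x y -> L x' y' -> L (x + x') (y + y').
  by move=> Lxy L'; rewrite -(opprK x') -(opprK y') LB ?LN.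
have LM x y u : L x y -> L (u * x) (u * y).
  move=> Lxy; elim/int_ind: u => [|u IH|u IH]; first by rewrite !mul0r.
  - by rewrite -addn1 PoszD !mulrDl !mul1r LD.
  - by rewrite -addn1 PoszD opprD !mulrDl !mulN1r LD // LN.
have [M M_gt0 ML] := @int_ideal (L^~ 0) n n_gt0 Ln0 (fun x y => @LB x 0 y 0).
(* Reducing the first coordinate modulo [n] bounds it, which keeps this predicate boolean as
   [int_ideal] requires. *)
pose I y := [exists x : 'I_n, L (val x)%:Z y].
have IP y : reflect (exists x, L x y) (I y).
  apply: (iffP existsP) => [[x Lxy]|[x Lxy]]; first by exists (val x)%:Z.
  have r0 : 0 <= (x %% n)%Z by apply: modz_ge0; lia.
  have rn : (x %% n)%Z < n by apply: ltz_pmod; lia.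
  have rE : (`|(x %% n)%Z|%N < n)%N by lia.
  exists (Ordinal rE) => /=.
  have -> : `|(x %% n)%Z|%N%:Z = x - (x %/ n)%Z * n by have := divz_eq x n; lia.
  by rewrite -[y]subr0 -(mulr0 (x %/ n)%Z) LB // LM.
have [||K K_gt0 KI] := @int_ideal I n n_gt0.
- by apply/IP; exists 0.
- by move=> y y' /IP[x Lxy] /IP[x' Lxy']; apply/IP; exists (x - x'); apply: LB.
have /IP[s Ls] : I K by apply/KI; exists 1; rewrite mul1r.
exists M, K, s; split=> // x y; split=> [Lxy|[u [v [-> ->]]]].
  have /KI[v yE] : I y by apply/IP; exists x.
  have /ML[u uE] : L (x - v * s) 0 by rewrite -(subrr y) {2}yE LB // LM.
  by exists u, v; rewrite -uE subrK.
rewrite -(add0r (v * K%:Z)) LD //; last exact: LM.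
by apply/ML; exists u.
Qed.
End Hermite.

(** * Symmetries of lattices in the triangular plane *)

Section LatticeArithmetic.
Local Open Scope ring_scope.

Definition span (m k : nat) (s x y : int) :=
  exists u v, x = u * m%:Z + v * s /\ y = v * k%:Z.

Lemma spanN m k s x y : span m k s x y -> span m k s (- x) (- y).
Proof. by case=> u [v [-> ->]]; exists (- u), (- v); split; ring. Qed.

(** The map is the reflection in the first axis, as the directions at 60 and -60 degrees are (0, 1)
    and (1, -1). It fixes (m, 0) and takes (s, k) to a (m, 0) - (s, k). *)
Lemma span_reflect m k s a x y : 2%:Z * s + k%:Z = a * m%:Z ->
  span m k s x y -> span m k s (x + y) (- y).
Proof.
move=> E [u [v [-> ->]]]; exists (u + v * a), (- v); split; last ring.
have -> : (u + v * a) * m%:Z + - v * s = u * m%:Z + v * (a * m%:Z) - v * s by ring.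
by rewrite -E; ring.
Qed.

Lemma span_le m k m' k' s s' : (0 < m)%N -> (0 < k)%N -> (0 < m')%N -> (0 < k')%N ->
  (forall x y, span m k s x y -> span m' k' s' x y) ->
  (m' <= m)%N /\ (k' <= k)%N.
Proof.
move=> m0 k0 m'0 k'0 h; split.
  have [|u [v [E1 E2]]] := h m%:Z 0; first by exists 1, 0; lia.
  have v0 : v = 0 by nia.
  have u0 : 0 < u by nia.
  nia.
have [|u [v [_ E2]]] := h s k%:Z; first by exists 0, 1; lia.
have v0 : 0 < v by nia.
nia.
Qed.

(** Uniqueness of the Hermite normal form: mutual inclusion equates [m] and [k], after which [s] and
    [s'] differ by a multiple of [m] smaller than [m]. *)
Lemma span_inj m k m' k' (s s' : nat) : (0 < m)%N -> (0 < k)%N -> (0 < m')%N -> (0 < k')%N ->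
  (s < m)%N -> (s' < m')%N ->
  (forall x y, span m k s x y <-> span m' k' s' x y) -> (k, m, s) = (k', m', s').
Proof.
move=> m0 k0 m'0 k'0 sm sm' h.
have [m1 k1] := span_le m0 k0 m'0 k'0 (fun x y => (h x y).1).
have [m2 k2] := span_le m'0 k'0 m0 k0 (fun x y => (h x y).2).
have mE : m' = m by lia. have kE : k' = k by lia.
rewrite {m1 k1 m2 k2}mE {}kE in h sm' *.
have /h[u [v [E1 E2]]] : span m k s s%:Z k%:Z by exists 0, 1; lia.
have v1 : v = 1 by nia.
suff -> : s = s' by [].
rewrite v1 in E1.
by (have [|[|]] : u = 0 \/ 1 <= u \/ u <= -1 by lia); nia.
Qed.

(* Two adjacent axes of symmetry compose to a rotation of order 3. *)
Lemma span_rotate m k s m' k' s' a a' :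
  2%:Z * s + k%:Z = a * m%:Z -> 2%:Z * s' + k'%:Z = a' * m'%:Z ->
  (forall x y, span m' k' s' x y <-> span m k s (- y) (x + y)) ->
  forall x y, span m k s (- y) (x + y) <-> span m k s x y.
Proof.
move=> E E' h.
(* [rho] is the rotation by 120 degrees: the reflection in the first axis, then the one in the next
   axis, carried out in the frame of the second lattice. *)
have rho x y : span m k s x y -> span m k s (- x - y) x.
  move/(span_reflect E) => H.
  have /(span_reflect E')/h : span m' k' s' x (- x - y).
    by apply/h; move: H; congr span; ring.
  by congr span; ring.
(* The rotation by 60 degrees is minus the square of [rho], and its inverse is minus [rho]. *)
move=> x y; split=> [/rho/spanN|/rho/rho/spanN]; by congr span; ring.
Qed.

(** Rotating (m, 0) to (0, m) gives m = n k; rotating (s, k) to (-k, s + k) gives s = t k and n |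
    t^2 + t + 1. With n | 2 t + 1 this leaves n = 1 or n = 3. *)
Lemma span_hexagonal m k (s : nat) a : (0 < m)%N -> (0 < k)%N -> (s < m)%N ->
  2%:Z * s%:Z + k%:Z = a * m%:Z ->
  (forall x y, span m k s x y -> span m k s (- y) (x + y)) ->
  (k, m, s) = (k, k, 0%N) \/ (k, m, s) = (k, (3 * k)%N, k).
Proof.
move=> m0 k0 sm E h.
have [|u [n [_ mE]]] := h m%:Z 0; first by exists 1, 0; lia.
have [|w [v [wE vE]]] := h s%:Z k%:Z; first by exists 0, 1; lia.
pose t := v - 1; have sE : s%:Z = t * k%:Z by rewrite /t; lia.
have mE' : m%:Z = n * k%:Z by lia.
have k1 : k%:Z != 0 by lia.
have E1 : 2%:Z * t + 1 = a * n.
  by apply: (mulIf k1); move: E; rewrite sE mE'; lia.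
have E2 : -1 = w * n + (t + 1) * t.
  by apply: (mulIf k1); move: wE; rewrite sE mE' /t; lia.
have t0 : 0 <= t by move: (t) sE k0; clear; nia.
have tn : t < n by move: (t) sE mE' sm k0; clear; nia.
(* This is 4 (t^2 + t + 1) - (2 t + 1)^2 = 3. *)
have n3 : n * (- 4%:Z * w - a * a * n) = 3.
  have -> : n * (- 4%:Z * w - a * a * n) = - 4%:Z * (w * n) - (a * n) * (a * n) by ring.
  have -> : w * n = -1 - (t + 1) * t by lia.
  by rewrite -E1; ring.
have n0 : 0 < n by lia.
have n_le : n <= 3.
  move: (_ - _) n3 n0 => z; clear=> n3 n0.
  by (have [|] : z <= 0 \/ 1 <= z by lia); nia.
have [n1|[n2|n3']] : n = 1 \/ n = 2 \/ n = 3 by lia.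
- have t1 : t = 0 by rewrite n1 in tn; lia.
  by left; rewrite n1 in mE'; rewrite t1 in sE; congr (_, _, _); lia.
- by exfalso; move: n3; rewrite n2; move: (_ - _) => z; lia.
- have t1 : t = 1 by rewrite n3' in E1 tn; lia.
  by right; rewrite n3' in mE'; rewrite t1 in sE; congr (_, _, _); lia.
Qed.
End LatticeArithmetic.

(** * Translations acting on the darts *)

Section Translations.
Variable G : rotation_system.

(* [half_turn] fixes the darts at the vertices of degree 3.  Hence [straight],
   which moves a dart one step forward and keeps its direction, turns back at
   such a vertex, as on the quotient of the plane by a half-turn.  [move x y]
   shifts by x steps in the direction of the dart and y steps in the direction
   60 degrees to its left. *)
Definition half_turn : {perm dart G} := (rot G ^+ 3)%g.
Definition straight : {perm dart G} := (opp G * half_turn)%g.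
Definition sideways : {perm dart G} := (rot G * straight * (rot G)^-1)%g.
Definition move (x y : int) (d : dart G) : dart G :=
  (expgz straight x * expgz sideways y)%g d.
Definition apex (d : dart G) : bool := half_turn d == d.

Hypothesis hG : in_P G.

Let tri_G d := let: And5 _ _ tri _ _ := hG in (tri d).1.

Lemma degree_tail (d : dart G) : degree (tail d) = 3 \/ degree (tail d) = 6.
Proof. by case: hG => _ _ _ _; apply; exact: imset_f. Qed.

Lemma rot6 : (rot G ^+ 6 = 1)%g.
Proof.
apply/permP => d; rewrite permX perm1.
by case: (degree_tail d) => h; have := iter_porbit (rot G) d; rewrite [#|_|]h /= => E;
  rewrite ?E.
Qed.

Lemma opp_sqr : (opp G * opp G = 1)%g.
Proof. by apply/permP => d; rewrite permM perm1 oppK. Qed.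

Lemma oppV : ((opp G)^-1 = opp G)%g.
Proof. by apply/eqP; rewrite eq_invg_mul opp_sqr. Qed.

Lemma face_cube : (face_perm G ^+ 3 = 1)%g.
Proof.
apply/permP => d; rewrite permX perm1 -[3](tri_G d); exact: iter_porbit.
Qed.

Lemma half_turn_sqr : (half_turn * half_turn = 1)%g.
Proof. by rewrite -expgD rot6. Qed.

Lemma opp_rotV_opp : (opp G * (rot G)^-1 * opp G = rot G * opp G * rot G)%g.
Proof.
apply: (mulIg ((rot G)^-1 * opp G * (rot G)^-1)%g).
rewrite !mulgA mulgK -[(_ * opp G * opp G)%g]mulgA opp_sqr mulg1 mulgV.
by rewrite -face_cube /face_perm !expgS expg0 mulg1 !mulgA.
Qed.

Lemma opp_rot_opp : (opp G * rot G * opp G = (rot G)^-1 * opp G * (rot G)^-1)%g.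
Proof. by apply: invg_inj; rewrite !invMg !invgK oppV !mulgA opp_rotV_opp.
Qed.

Lemma sidewaysE : (sideways = rot G * opp G * rot G * rot G)%g.
Proof.
by rewrite /sideways /straight /half_turn !expgS expg0 mulg1 !mulgA mulgK.
Qed.

(** A step forward and a step 120 degrees to the left, which is the conjugate of [sideways] by
    [rot G], add up to a step 60 degrees to the left. *)
Lemma straight_side2 : (straight * (rot G * sideways * (rot G)^-1) = sideways)%g.
Proof.
rewrite sidewaysE /straight !mulgA mulgK -opp_rotV_opp.
have <- : (half_turn * (rot G * rot G) = (rot G)^-1)%g.
  by apply: (mulIg (rot G)); rewrite mulVg -rot6 /half_turn !expgS expg0 mulg1 !mulgA.
by rewrite !mulgA.
Qed.

Lemma side2_straight : ((rot G * sideways * (rot G)^-1) * straight = sideways)%g.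
Proof.
rewrite sidewaysE /straight !mulgA mulgK.
have -> : (rot G * rot G * opp G * rot G * opp G =
    rot G * rot G * (opp G * rot G * opp G))%g by rewrite !mulgA.
rewrite opp_rot_opp !mulgA mulgK.
by rewrite mulgKV.
Qed.

(** [straight] and the step at 120 degrees compose to [sideways] in either order; associativity does
    the rest. *)
Lemma straight_sideways : commute straight sideways.
Proof.
rewrite /commute -{1}side2_straight -{2}straight_side2; exact: mulgA.
Qed.

Lemma move0 d : move 0 0 d = d.
Proof. by rewrite /move /= mulg1 perm1. Qed.

Lemma moveD x y x' y' d : move x y (move x' y' d) = move (x + x')%R (y + y')%R d.
Proof.
rewrite /move -permM; congr (fun_of_perm _ d).
rewrite (addrC x) (addrC y) !expgzD !mulgA; congr mulg.
rewrite -!mulgA; congr mulg; exact/esym/commute_expgz2/straight_sideways.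
Qed.

Lemma move_cancel x y d d' : move x y d = d' <-> d = move (- x)%R (- y)%R d'.
Proof. by split=> [<-|->]; rewrite moveD ?addNr ?addrN move0. Qed.

Lemma move_inj x y : injective (move x y).
Proof. by move=> d d' /move_cancel ->; rewrite moveD !addNr move0. Qed.

Lemma straightE d : straight d = move 1 0 d.
Proof. by rewrite /move /= mulg1 expg1. Qed.

Lemma iter_straight n d : iter n straight d = move n 0 d.
Proof. by rewrite /move /= mulg1 permX. Qed.

Lemma move_rot x y d : move x y (rot G d) = rot G (move (- y)%R (x + y)%R d).
Proof.
rewrite /move -!permM; congr (fun_of_perm _ d).
have E1 : (rot G * straight = sideways * rot G)%g by rewrite /sideways mulgKV.
have E2 : (rot G * sideways = (straight^-1 * sideways) * rot G)%g.
  apply: (mulIg (rot G)^-1)%g; rewrite mulgK; apply: (mulgI straight).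
  by rewrite mulKVg straight_side2.
move: straight_sideways E1 E2; move: straight sideways => a b C E1 E2.
rewrite mulgA (expgz_conj _ E1) -!mulgA (expgz_conj _ E2) !mulgA; congr mulg.
rewrite (expgz_prod _ (commute_sym (commuteV (commute_sym C)))).
have -> : expgz (a^-1)%g y = expgz a (- y)%R.
  by rewrite expgzN; case: y => n /=; rewrite ?expVgn.
rewrite expgzD !mulgA; congr mulg.
exact: esym (commute_expgz2 _ _ C).
Qed.

Lemma half_turnE d : half_turn d = rot G (rot G (rot G d)).
Proof. by rewrite permX. Qed.

Lemma half_turnK : involutive half_turn.
Proof. by move=> d; rewrite -permM half_turn_sqr perm1. Qed.

Lemma move_half_turn x y d :
  move x y (half_turn d) = half_turn (move (- x)%R (- y)%R d).
Proof.
rewrite !half_turnE !move_rot; congr (rot G (rot G (rot G (move _ _ _)))); ring.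
Qed.

Lemma straight_opp d : straight d = half_turn (opp G d).
Proof. exact: permM. Qed.

Lemma half_turn_move x y d : apex d -> half_turn (move x y d) = move (- x)%R (- y)%R d.
Proof. by move=> /eqP hd; rewrite -[in RHS]hd move_half_turn !opprK. Qed.

Lemma opp_move d : opp G d = half_turn (move 1 0 d).
Proof. by rewrite -straightE straight_opp half_turnK. Qed.

Lemma rot_half_turn d : rot G (half_turn d) = half_turn (rot G d).
Proof. by rewrite !half_turnE. Qed.

(** The half-turn about [tail d] negates positions, so it fixes a position exactly when the double
    stabilises [d]. *)
Lemma apex_move x y d : apex d ->
  apex (move x y d) = (move (x + x)%R (y + y)%R d == d).
Proof.
move=> hd; rewrite /apex half_turn_move // eq_sym -(inj_eq (@move_inj x y)).
by rewrite !moveD !addrN move0.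
Qed.

Lemma apex_rot d : apex (rot G d) = apex d.
Proof. by rewrite /apex -rot_half_turn (inj_eq perm_inj). Qed.

Lemma tail_rot d : tail (rot G d) = tail d.
Proof. by rewrite /tail -[rot G d]/(rot G d) -(porbit_perm (rot G) 1 d) expg1. Qed.

Lemma tail_half_turn d : tail (half_turn d) = tail d.
Proof. by rewrite half_turnE !tail_rot. Qed.

Lemma head_straight d : head d = tail (straight d).
Proof. by rewrite straight_opp tail_half_turn. Qed.

Lemma degree_apex (d : dart G) : (degree (tail d) == 3) = apex d.
Proof.
apply/eqP/eqP => [h|h].
  by rewrite permX -[3]h; exact: iter_porbit.
case: (degree_tail d) => // h6; exfalso.
have := uniq_traject_porbit (rot G) d; rewrite -[#|_|]/(degree (tail d)) h6 /=.
by move: h; rewrite half_turnE => ->; rewrite !inE eqxx !orbT.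
Qed.

(** * Classes of edges and transitivity of the translations *)

Variable c : dart G -> 'Z_3.
Hypothesis hc : class_partition c.

Lemma class_opp d : c (opp G d) = c d.
Proof. by case: (hc d). Qed.

Lemma class_rot d : c (rot G d) = (c d + 1)%R.
Proof. by case: (hc d). Qed.

Lemma class_half_turn d : c (half_turn d) = c d.
Proof. by rewrite half_turnE !class_rot; case: (c d) => [[|[|[|]]]] // i; apply: val_inj. Qed.

Lemma class_straight d : c (straight d) = c d.
Proof. by rewrite straight_opp class_half_turn class_opp. Qed.

Lemma class_expgz (s : {perm dart G}) m d :
  (forall e, c (s e) = c e) -> c (expgz s m d) = c d.
Proof.
move=> h; have hn n e : c ((s ^+ n)%g e) = c e.
  by rewrite permX; elim: n => //= n <-; rewrite h.
case: m => n /=; first exact: hn.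
by rewrite -[in RHS](permKV (s ^+ n.+1)%g d) hn.
Qed.

Lemma class_move x y d : c (move x y d) = c d.
Proof.
rewrite /move permM !class_expgz // => [e|e]; first exact: class_straight.
have E : rot G (sideways e) = straight (rot G e).
  by rewrite -!permM /sideways mulgKV.
by apply: (addIr 1%R); rewrite -!class_rot E class_straight.
Qed.

(** Each rotation raises the class by one, so among at most six rotations only the identity and the
    half-turn preserve it. *)
Lemma same_tail_and_class d d' : tail d = tail d' -> c d = c d' ->
  d = d' \/ d = half_turn d'.
Proof.
move=> /eqP; rewrite eq_porbit_mem porbit_traject => /trajectP[i].
rewrite -[#|_|]/(degree (tail d')) => hi -> hci.
have {hi} : i < 6 by case: (degree_tail d') hi => ->; lia.
move: i hci => [|[|[|[|[|[|//]]]]]] /=; rewrite ?class_rot => E _.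
- by left.
- by move: E; case: (c d') => [[|[|[|]]]].
- by move: E; case: (c d') => [[|[|[|]]]].
- by right; rewrite half_turnE.
- by move: E; case: (c d') => [[|[|[|]]]].
- by move: E; case: (c d') => [[|[|[|]]]].
Qed.

Lemma tail_eq d d' : c d = c d' ->
  tail d = tail d' <-> d = d' \/ d = half_turn d'.
Proof.
move=> hcd; split => [/same_tail_and_class|]; first exact.
by case=> ->; rewrite ?tail_half_turn.
Qed.

Lemma exists_dart_of_class (d : dart G) q : exists2 e, tail e = tail d & c e = q.
Proof.
case: (Z3_cases (c d) q) => [E|[E|E]].
- by exists d.
- by exists (rot G d); rewrite ?tail_rot ?class_rot.
- by exists (rot G (rot G d)); rewrite ?tail_rot ?class_rot.
Qed.

Definition reachable (d0 d : dart G) :=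
  exists i x y, d = (rot G ^+ i)%g (move x y d0).

Lemma reachable_rot d0 d i : reachable d0 ((rot G ^+ i)%g d) <-> reachable d0 d.
Proof.
have S e j : reachable d0 e -> reachable d0 ((rot G ^+ j)%g e).
  by case=> k [x [y ->]]; exists (k + j), x, y; rewrite expgD permM.
split; last exact: S.
move/(S _ (i * 5)); rewrite -permM -expgD.
have -> : i + i * 5 = 6 * i by lia.
by rewrite expgM rot6 expg1n perm1.
Qed.

(* The last equation says that the rotated translation has the same length:
   x^2 + x y + y^2 is the norm form of the triangular lattice. *)
Lemma move_iter_rot i x y d : exists x' y',
  move x y ((rot G ^+ i)%g d) = (rot G ^+ i)%g (move x' y' d) /\
  (x' * x' + x' * y' + y' * y' = x * x + x * y + y * y)%R.
Proof.
elim: i x y => [|i IH] x y; first by exists x, y; rewrite !expg0 !perm1.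
rewrite expgSr permM move_rot; case: (IH (- y)%R (x + y)%R) => x' [y' [-> E]].
by exists x', y'; rewrite permM E; split=> //; ring.
Qed.

Lemma reachable_opp d0 d : reachable d0 d -> reachable d0 (opp G d).
Proof.
case=> i [x [y ->]]; rewrite opp_move; case: (move_iter_rot i 1 0 (move x y d0)).
move=> x' [y' [-> _]]; rewrite moveD; apply/(reachable_rot _ _ 3)/reachable_rot.
by exists 0, (x' + x)%R, (y' + y)%R; rewrite expg0 perm1.
Qed.

(** Reachability is invariant under [rot] and [opp], hence propagates along the walks of the
    connected graph. *)
Lemma all_reachable d0 d : reachable d0 d.
Proof.
case: hG => _ [con _] _ _ _.
have V e : tail e \in vertices G by apply: imset_f.
case/connectP: (con _ _ (V d0) (V d)) => p hp hl.
have T e e' : tail e = tail e' -> reachable d0 e -> reachable d0 e'.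
  move=> /esym/eqP; rewrite eq_porbit_mem => /porbitP[i ->] ?.
  exact/reachable_rot.
have : reachable d0 d0 by exists 0, 0%R, 0%R; rewrite move0 perm1.
elim: p {1 2 4}d0 hp hl => [|v p IH] e /= => [_ /esym|]; first exact: T.
case/andP=> /existsP[f /andP[/eqP fe /eqP fv]] hp hl he.
rewrite -fv in hp hl; apply: (IH (opp G f) hp hl); 
exact: reachable_opp (T _ _ (esym fe) he).
Qed.

(** Beside the identity only the half-turn preserves the class, and at a vertex of degree 3 it
    merely negates the translation. *)
Lemma same_class_move d0 d : apex d0 -> c d = c d0 -> exists x y, d = move x y d0.
Proof.
move=> hd0 hcd; case: (all_reachable d0 d) => i [x [y E]].
case: (@same_tail_and_class d (move x y d0)); first 2 last.
- by exists x, y.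
- by move->; exists (- x)%R, (- y)%R; rewrite half_turn_move.
- by rewrite E /tail porbit_perm.
- by rewrite class_move.
Qed.

(** * Euler's formula and the lattice of the vertices of degree 3 *)

Lemma card_opp_orbit d : #|porbit (opp G) d| = 2.
Proof.
have -> : porbit (opp G) d = [set d; opp G d]; last by rewrite cards2 eq_sym opp_neq.
apply/setP => e; rewrite !inE; apply/porbitP/orP => [[i ->]|].
  rewrite permX; elim: i => [|i IH] /=; first by left.
  by case: IH => /eqP->; rewrite ?oppK ?eqxx; [right|left].
by case=> /eqP->; [exists 0; rewrite perm1|exists 1; rewrite expg1].
Qed.

(* Euler's formula with 2E = 3F = sum of the degrees. *)
Lemma card_degree3 : #|[set v in vertices G | degree v == 3]| = 4.
Proof.
case: hG => _ [_ euler] _ _ deg.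
have E2 := card_uniform_porbits card_opp_orbit.
have E3 := card_uniform_porbits tri_G.
(* Adding 3 at each vertex of degree 3 makes every term 6. *)
have : \sum_(v in vertices G) (#|v| + 3 * (degree v == 3)) = #|vertices G| * 6.
  by rewrite -sum_nat_const; apply: eq_bigr => v /deg; rewrite /degree; case=> ->.
rewrite big_split /= sum_porbits -big_distrr /= -big_mkcondr sum1dep_card.
rewrite -/(vertices G) in euler *.
have arith (n e f v u : nat) : e * 2 = n -> f * 3 = n -> v + f = e + 2 ->
  n + 3 * u = v * 6 -> u = 4 by lia.
exact: arith E2 E3 euler.
Qed.

(** Each vertex of degree 3 carries exactly one dart of each class. *)
Lemma card_apex q : #|[set d | apex d && (c d == q)]| = 4.
Proof.
rewrite -card_degree3 -(card_in_imset (f := @tail G)); last first.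
  move=> d e; rewrite !inE => /andP[_ /eqP hd] /andP[/eqP he /eqP hce] /tail_eq[];
    rewrite ?hd ?hce //.
  by rewrite he.
congr #|pred_of_set _|; apply/setP => v; rewrite inE; apply/imsetP/andP => [[d]|[]].
  by rewrite inE -degree_apex => /andP[? _] ->; split=> //; apply: imset_f.
case/imsetP=> d _ -> hd; have [e et ec] := exists_dart_of_class d q.
by exists e; rewrite ?et // inE -degree_apex et hd ec eqxx.
Qed.

Lemma exists_apex q : exists2 d, apex d & c d = q.
Proof.
have /card_gt0P[d] : 0 < #|[set d | apex d && (c d == q)]| by rewrite card_apex.
by rewrite inE => /andP[? /eqP]; exists d.
Qed.

(* With L the lattice of basis (m, 0), (s, k), the stabiliser of [d] is 2L; if
   [d] leaves a vertex of degree 3, then L consists of the positions of all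
   these vertices relative to [d] (see [lattice_apex]). *)
Definition lattice (d : dart G) (m k : nat) (s : int) :=
  [/\ (0 < m)%N, (0 < k)%N & forall x y, move x y d = d <->
    exists u v, x = 2%:Z * (u * m%:Z + v * s) /\ y = 2%:Z * (v * k%:Z)]%R.

(* Let L be the set of positions of the vertices of degree 3.  The stabiliser of
   [d0] lies between 2L and L, and it has index 4 in L as there are exactly four
   such vertices; hence it is 2L. *)
Lemma exists_lattice d0 : apex d0 -> exists m k s, lattice d0 m k s.
Proof.
move=> hd.
pose n := (#[straight]%g * #[sideways]%g)%N.
have n_gt0 : 0 < n by rewrite muln_gt0 !order_gt0.
have n1 : move n 0 d0 = d0.
  by rewrite /move /= mulg1 expgM expg_order expg1n perm1.
have n2 : move 0 n d0 = d0.
  by rewrite /move /n /= mul1g mulnC expgM expg_order expg1n perm1.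
have stab x y x' y' : move x y d0 = d0 -> move (x + x')%R (y + y')%R d0 = move x' y' d0.
  by move=> E; rewrite addrC [(y + _)%R]addrC -moveD E.
have [|||m [k [s [m_gt0 k_gt0 hL]]]] :=
  @hermite_normal_form (fun x y => apex (move x y d0)) n n_gt0.
- by rewrite apex_move // -moveD !n1.
- by rewrite apex_move // -moveD !n2.
- move=> x y x' y'; rewrite !apex_move // => /eqP E /eqP E'; apply/eqP.
  have -> : (x - x' + (x - x') = (x + x) - (x' + x'))%R by ring.
  have -> : (y - y' + (y - y') = (y + y) - (y' + y'))%R by ring.
  by rewrite stab //; apply/esym/move_cancel.
have double u v : move (2%:Z * (u * m%:Z + v * s))%R (2%:Z * (v * k%:Z))%R d0 = d0.
  have : apex (move (u * m%:Z + v * s)%R (v * k%:Z)%R d0) by apply/hL; exists u, v.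
  rewrite apex_move // => /eqP; congr (move _ _ _ = _); lia.
pose f (p : bool * bool) := move (p.1%:Z * m%:Z + p.2%:Z * s)%R (p.2%:Z * k%:Z)%R d0.
have par (w : int) : exists (b : bool) w', (w = 2%:Z * w' + b%:Z)%R.
  exists (w %% 2 != 0)%Z, (w %/ 2)%Z; lia.
have fE u v : exists2 p, move (u * m%:Z + v * s)%R (v * k%:Z)%R d0 = f p &
    (p = (false, false) -> exists u' v', u = 2%:Z * u' /\ v = 2%:Z * v')%R.
  have [[b1 [u' uE]] [b2 [v' vE]]] := (par u, par v).
  exists (b1, b2) => [|[b1E b2E]]; last first.
    by exists u', v'; move: uE vE; rewrite b1E b2E !addr0.
  rewrite /f /= -{2}(double u' v') moveD uE vE; congr (move _ _ _); ring.
(* [f] runs over representatives of L modulo 2L. It maps the four pairs onto the four darts counted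
   by [card_apex], so it is injective. *)
have f_inj : injective f.
  suff E : f @: setT = [set d | apex d && (c d == c d0)].
    move=> p p'; apply: (imset_injP (D := setT) (f := f)); rewrite ?inE //.
    by rewrite E card_apex cardsT card_prod !card_bool.
  apply/setP => d; rewrite inE; apply/imsetP/andP => [[p _ ->]|[ad /eqP cd]].
    by rewrite class_move eqxx; split=> //; apply/hL; exists (Posz p.1), (Posz p.2).
  have [x [y dE]] := same_class_move hd cd.
  move: ad; rewrite dE => /hL[u [v [-> ->]]].
  by have [p pE _] := fE u v; exists p.
exists m, k, s; split=> // x y; split=> [E|[u [v [-> ->]]]]; last exact: double.
have /hL[u [v [xE yE]]] : apex (move x y d0) by rewrite E.
have [p pE p0] := fE u v.
(* A translation stabilising [d0] has the same value of [f] as 0, so both its coefficients are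
   even. *)
have /p0[u' [v' [uE vE]]] : p = (false, false).
  by apply: f_inj; rewrite -pE -xE -yE E /f /= !mul0r add0r move0.
by exists u', v'; rewrite xE yE uE vE; split; ring.
Qed.

Lemma lattice_move d m k s x y : lattice d m k s -> lattice (move x y d) m k s.
Proof.
case=> m_gt0 k_gt0 h; split=> // x' y'; rewrite -h moveD addrC [(y' + y)%R]addrC -moveD.
by split=> [/move_inj|->].
Qed.

Lemma lattice_class d d' m k s : apex d -> c d' = c d -> lattice d m k s -> lattice d' m k s.
Proof.
by move=> hd hc' hL; case: (same_class_move hd hc') => x [y ->]; apply: lattice_move.
Qed.

Lemma lattice_apex d m k s x y : lattice d m k s -> apex d ->
  apex (move x y d) <-> exists u v, (x = u * m%:Z + v * s /\ y = v * k%:Z)%R.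
Proof.
case=> _ _ h hd; rewrite apex_move //; split=> [/eqP/h[u [v [xE yE]]]|[u [v [-> ->]]]].
  by exists u, v; lia.
by apply/eqP/h; exists u, v; lia.
Qed.

Lemma move_eq d x y x' y' :
  move x y d = move x' y' d <-> move (x - x')%R (y - y')%R d = d.
Proof.
split=> [/(congr1 (move (- x')%R (- y')%R))|/(congr1 (move x' y'))].
  by rewrite !moveD !addNr move0 addrC [(- y' + y)%R]addrC.
by rewrite moveD addrC subrK [(y' + _)%R]addrC subrK.
Qed.

Lemma tail_move d x y x' y' : apex d -> tail (move x y d) = tail (move x' y' d) <->
  move (x - x')%R (y - y')%R d = d \/ move (x + x')%R (y + y')%R d = d.
Proof.
move=> hd; rewrite tail_eq ?class_move // half_turn_move // !move_eq !opprK.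
by [].
Qed.

Lemma verts_traject d m :
  verts (tail d) (traject straight d m) = [seq tail e | e <- traject straight d m.+1].
Proof.
rewrite /verts /=; congr (_ :: _).
by elim: m d => //= m IH d; rewrite head_straight IH.
Qed.

Lemma mem_verts_traject d m v :
  reflect (exists2 i, i <= m & v = tail (move i 0 d))
    (v \in verts (tail d) (traject straight d m)).
Proof.
rewrite verts_traject; apply: (iffP mapP) => [[e /trajectP[i im ->] ->]|[i im ->]].
  by exists i => //; rewrite iter_straight.
by exists (move i 0 d) => //; apply/trajectP; exists i; rewrite ?iter_straight.
Qed.

Lemma class_traject d m e : e \in traject straight d m -> c e = c d.
Proof. by case/trajectP=> i _ ->; rewrite iter_straight class_move. Qed.

Lemma opp_path d i : 0 < i -> opp G (move i.-1 0 d) = half_turn (move i 0 d).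
Proof. by move=> i0; rewrite opp_move moveD; congr (half_turn (move _ _ _)); lia. Qed.

(** * Maximal paths of a class *)

Section MaximalPath.
Variables (d : dart G) (m k : nat) (s : int).
Hypotheses (hd : apex d) (hL : lattice d m k s).

Let p := traject straight d m.
Let V := verts (tail d) p.

Let m_gt0 : 0 < m. Proof. by case: hL. Qed.

Lemma move_axis (x : int) : move x 0 d = d <-> exists u, (x = 2%:Z * u * m%:Z)%R.
Proof.
case: hL => m0 k0 ->; split=> [[u [v [-> E]]]|[u ->]]; last by exists u, 0%R; lia.
have -> : v = 0%R by nia.
by exists u; lia.
Qed.

Lemma apex_axis (x : int) : apex (move x 0 d) <-> exists u, (x = u * m%:Z)%R.
Proof.
rewrite (lattice_apex _ _ hL hd); case: hL => m0 k0 _.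
split=> [[u [v [-> E]]]|[u ->]]; last by exists u, 0%R; lia.
have -> : v = 0%R by nia.
by exists u; lia.
Qed.

Lemma apex_path_end : apex (move m 0 d).
Proof. by apply/apex_axis; exists 1%R; lia. Qed.

(** The vertices agree only if 2 m divides i - j or i + j; between 0 and [m] either forces i = j. *)
Lemma tail_path_inj i j : i <= m -> j <= m ->
  tail (move i 0 d) = tail (move j 0 d) -> i = j.
Proof.
move=> im jm /(tail_move _ _ _ _ hd).
have m0 := m_gt0.
by case=> /move_axis[u E]; (have [|[]] : (u = 0 \/ 1 <= u \/ u <= -1)%R by lia); nia.
Qed.

Lemma uniq_path_verts : uniq V.
Proof.
rewrite /V verts_traject map_inj_in_uniq; last first.
  move=> e e' /trajectP[i im ->] /trajectP[j jm ->].
  by rewrite !iter_straight => /tail_path_inj -> //.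
apply/(uniqP d) => i j; rewrite !inE size_traject => im jm.
rewrite !nth_traject // !iter_straight => E.
by apply: tail_path_inj => //; rewrite E.
Qed.

Lemma path_tails : [seq tail e | e <- p] = belast (tail d) [seq head e | e <- p].
Proof.
rewrite /p; elim: m d => //= n IH e.
by rewrite IH head_straight.
Qed.

Lemma class_path_traject : class_path c (c d) (tail d) p.
Proof.
apply/and4P; split; first exact: imset_f.
- by rewrite path_tails.
- by apply/allP => e /class_traject /= ->.
- exact: uniq_path_verts.
Qed.

(** An inner vertex has two darts of the class, one forward and one backward on the path, and an end
    has a single one, so the path misses no edge of its class at its vertices. *)
Lemma mem_edges_path e : (e \in edges p) = (c e == c d) && (tail e \in V).
Proof.
rewrite inE; apply/orP/andP => [|[/eqP ce /mem_verts_traject[i im te]]].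
  have S e' i : i < m -> e' = move i 0 d -> c e' == c d /\ tail e' \in V.
    move=> im ->; rewrite class_move; split=> //.
    by apply/mem_verts_traject; exists i => //; lia.
  case=> /trajectP[i im]; rewrite iter_straight => E; first exact: S E.
  rewrite -(class_opp e) E class_move eqxx; split=> //.
  have -> : tail e = head (opp G e) by rewrite /head oppK.
  rewrite E head_straight straightE moveD; apply/mem_verts_traject; exists i.+1 => //.
have case1 j : j < m -> e = move j 0 d -> e \in p \/ opp G e \in p.
  by move=> jm ->; left; apply/trajectP; exists j; rewrite ?iter_straight.
have case2 : 0 < i -> e = half_turn (move i 0 d) -> e \in p \/ opp G e \in p.
  move=> i0; rewrite -opp_path // => ->; right; rewrite oppK.
  by apply/trajectP; exists i.-1; rewrite ?iter_straight //; lia.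
have [E|E] : e = move i 0 d \/ e = half_turn (move i 0 d).
  by apply: same_tail_and_class; rewrite ?class_move.
  have [im'|] := ltnP i m; first exact: case1 E.
  move=> mi; have iE : i = m by lia.
  by apply: case2; rewrite iE // E iE; apply/esym/eqP/apex_path_end.
have [i0|i0] : 0 < i \/ i = 0 by lia.
  exact: case2.
apply: (case1 0) => //; rewrite E i0 move0; exact/eqP.
Qed.

Lemma head_in_path e : c e = c d -> (head e \in V) = (tail e \in V).
Proof.
move=> ce; have := mem_edges_path e; have := mem_edges_path (opp G e).
rewrite class_opp ce eqxx /= => <- <-; rewrite !inE oppK orbC.
by [].
Qed.

(** Edges of the class have both ends in [V] or none, so membership in [V] is constant along a
    path. *)
Lemma class_path_closed B r : [seq tail e | e <- r] = belast B [seq head e | e <- r] ->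
  all [pred e | c e == c d] r -> {in verts B r, forall v, (v \in V) = (B \in V)}.
Proof.
elim: r B => [|e r IH] B /=; first by move=> _ _ v; rewrite inE => /eqP->.
case=> tB tr /andP[/eqP ce cr] v; rewrite inE => /predU1P[-> //|].
by move/(IH _ tr cr) ->; rewrite head_in_path ?tB.
Qed.

(** At each vertex the other dart of the class leads back to the vertex just visited, so the path
    has no choice; at position [m] the degree is 3 and only the way back remains. *)
Lemma class_path_prefix r : class_path c (c d) (tail d) r ->
  size r <= m /\ r = traject straight d (size r).
Proof.
case/and4P=> _ /eqP; elim/last_ind: r => [//|r e IH].
rewrite !map_rcons belast_rcons => tE.
have := tE; rewrite lastI => /rcons_inj[tr _].
rewrite all_rcons /verts map_rcons -rcons_cons rcons_uniq.
case/andP=> /eqP ce cr /andP[hN ur].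
have [rm rE] := IH tr cr ur; rewrite size_rcons.
have V_r : tail d :: map (@head G) r = map (@tail G) (traject straight d (size r).+1).
  by rewrite -verts_traject -rE.
have te : tail e = tail (move (size r) 0 d).
  move: tE; rewrite V_r trajectSr -rE map_rcons iter_straight => /rcons_inj[]; exact.
rewrite V_r in hN.
have not_back i : i < size r -> head e <> tail (move i 0 d).
  move=> ir hE; case/negP: hN; rewrite hE; apply: map_f; apply/trajectP.
  by exists i; rewrite ?iter_straight //; lia.
have not_turn : 0 < size r -> e <> half_turn (move (size r) 0 d).
  move=> r0; rewrite -opp_path // => E; apply: (not_back (size r).-1); first lia.
  by rewrite E /head oppK.
have r_lt : size r = 0 \/ 0 < size r by lia.
have eE : e = move (size r) 0 d.
  have ce' : c e = c (move (size r) 0 d) by rewrite class_move.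
  have [//|E] := same_tail_and_class te ce'.
  case: r_lt => [r0|/not_turn//]; rewrite E r0 move0; exact/eqP.
split; last by rewrite trajectSr -rE iter_straight -eE.
have [//|mr] := ltnP (size r) m; exfalso.
have rE' : size r = m by lia.
apply: not_turn; first by have := m_gt0; lia.
by rewrite eE rE'; apply/esym/eqP/apex_path_end.
Qed.

Lemma subpath_prefix n : n <= m -> subpath (tail d) (traject straight d n) (tail d) p.
Proof.
move=> nm; apply/andP; split.
  apply/allP => v /mem_verts_traject[i im ->]; apply/mem_verts_traject.
  by exists i => //; lia.
apply/subsetP => e; rewrite !inE.
have S e' : e' \in traject straight d n -> e' \in p.
  by case/trajectP=> i im ->; apply/trajectP; exists i => //; lia.
by case/orP=> /S ->; rewrite ?orbT.
Qed.

Lemma max_class_path_traject : max_class_path c (c d) (tail d) p.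
Proof.
apply/andP; split; first exact: class_path_traject.
apply/forallP => B; apply/forallP => r; apply/implyP => /andP[/and4P[_ /eqP tr cr _]].
case/andP=> /allP subV _; have BV : B \in V.
  have dB : tail d \in verts B r by apply: subV; rewrite inE eqxx.
  by rewrite -(class_path_closed tr cr dB) inE eqxx.
have rV v : v \in verts B r -> v \in V by move=> /(class_path_closed tr cr) ->.
have rp e : e \in (r : seq _) -> e \in edges p.
  move=> er; have /eqP ce := allP cr e er.
  by rewrite mem_edges_path ce eqxx -head_in_path // rV // inE map_f ?orbT.
apply/andP; split; first by apply/allP => v /rV.
apply/subsetP => e; rewrite inE => /orP[/rp //|/rp].
by rewrite !inE oppK orbC.
Qed.

(** [pick] returns some maximal path from [tail d]. It is a prefix of [p], and its maximality
    against [p] forces equal numbers of vertices. *)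
Lemma maxpathE : maxpath c (tail d) (c d) = p.
Proof.
have sp : size p = m by rewrite size_traject.
have up : uniq p.
  have := uniq_path_verts; rewrite /V verts_traject => /map_uniq.
  by rewrite trajectSr rcons_uniq => /andP[].
have sz : size p <= #|dart G| by rewrite -(card_uniqP up) max_card.
rewrite /maxpath; case: pickP => [r /andP[cr mr]|/(_ (Bseq sz))]; last first.
  by rewrite max_class_path_traject.
have [rm rE] := class_path_prefix cr.
have /forallP/(_ (tail d))/forallP/(_ (Bseq sz)) := mr.
rewrite class_path_traject {1}rE subpath_prefix //= => /andP[/allP sub _].
rewrite rE; congr traject; apply/eqP; rewrite eqn_leq rm /=.
have := uniq_leq_size uniq_path_verts sub.
by rewrite /verts /= !size_map sp.
Qed.

End MaximalPath.

(** * Relative position of the two maximal paths of a class *)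

Section Frame.
Variables (d : dart G) (m k : nat) (s : int).
Hypotheses (hd : apex d) (hL : lattice d m k s).

Let p := traject straight d m.
Let V := verts (tail d) p.

Lemma move_period x y u v :
  (move (x + 2%:Z * (u * m%:Z + v * s)) (y + 2%:Z * (v * k%:Z)) d = move x y d)%R.
Proof.
case: hL => _ _ h; rewrite -moveD; congr move; apply/h; by exists u, v.
Qed.

Lemma move_axis_mod x : exists2 X, X < 2 * m &
  move x 0 d = move X 0 d /\ exists u, (X%:Z = x + 2%:Z * (u * m%:Z))%R.
Proof.
case: (hL) => m_gt0 _ _; have m2 : (2 * m%:Z != 0)%R by lia.
have r0 := modz_ge0 x m2; have rm := @ltz_pmod x (2 * m%:Z)%R.
have E := divz_eq x (2 * m%:Z)%R.
have XE : (`|(x %% (2 * m))%Z|%N%:Z = x + 2%:Z * (- (x %/ (2 * m))%Z * m%:Z))%R by lia.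
exists `|(x %% (2 * m))%Z|%N; first by lia.
split; last by exists (- (x %/ (2 * m))%Z)%R.
rewrite XE -(move_period x 0 (- (x %/ (2 * m))%Z)%R 0); congr (move _ _ d); lia.
Qed.

Lemma on_axis x y : tail (move x y d) \in V <-> exists w, (y = 2%:Z * (w * k%:Z))%R.
Proof.
split=> [/mem_verts_traject[i _ /(tail_move _ _ _ _ hd)]|[w ->]].
  case: (hL) => _ _ h [/h[u [v [_ E]]]|/h[u [v [_ E]]]]; by exists v; lia.
have -> : (move x (2%:Z * (w * k%:Z)) d = move (x - 2%:Z * (w * s)) 0 d)%R.
  by rewrite -[RHS](move_period _ _ 0 w); congr (move _ _ d); lia.
have [X Xm [-> _]] := move_axis_mod (x - 2%:Z * (w * s))%R.
apply/mem_verts_traject; have [Xm'|Xm'] := leqP X m; first by exists X.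
(* Beyond [m] the axis runs back over the path: positions X and 2 m - X share a vertex. *)
exists (2 * m - X); first lia.
rewrite -tail_half_turn half_turn_move // -(move_period _ _ 1 0).
by congr (tail (move _ _ d)); lia.
Qed.

Lemma edges_subset x y : apex (move x y d) -> (exists w, (y = 2%:Z * (w * k%:Z))%R) ->
  edges (traject straight (move x y d) m) \subset edges p.
Proof.
move=> hx [w yE]; apply/subsetP => e.
rewrite (mem_edges_path hx (lattice_move _ _ hL)) (mem_edges_path hd hL) class_move.
case/andP=> -> /mem_verts_traject[i _ ->]; rewrite moveD; apply/on_axis; exists w; lia.
Qed.

Lemma far_edges x y : apex (move x y d) -> ~ (exists w, (y = 2%:Z * (w * k%:Z))%R) ->
  edges p != edges (traject straight (move x y d) m).
Proof.
move=> hx hy; apply/eqP => /setP/(_ (move x y d)).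
rewrite (mem_edges_path hx (lattice_move _ _ hL)) (mem_edges_path hd hL) !class_move eqxx /=.
rewrite [in RHS]inE eqxx => /on_axis; exact: hy.
Qed.

End Frame.

Lemma lattice_shift d m k s u : lattice d m k s -> lattice d m k (s + u * m%:Z)%R.
Proof.
case=> m0 k0 h; split=> // x y; rewrite h; split=> -[a [b [-> ->]]].
  by exists (a - b * u)%R, b; split; ring.
by exists (a + b * u)%R, b; split; ring.
Qed.

Lemma near_edges d x y m k s : apex d -> lattice d m k s -> apex (move x y d) ->
  (exists w, (y = 2%:Z * (w * k%:Z))%R) ->
  edges (traject straight (move x y d) m) = edges (traject straight d m).
Proof.
move=> hd hL hx hy; apply/eqP; rewrite eqEsubset (edges_subset hd hL) //=.
have dE : d = move (- x)%R (- y)%R (move x y d) by rewrite moveD !addNr move0.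
have := @edges_subset (move x y d) m k s hx (lattice_move _ _ hL) (- x)%R (- y)%R.
rewrite -dE; apply=> //; case: hy => w ->; exists (- w)%R; lia.
Qed.

(** The second end is a point of L whose coefficient of (s, k) is odd, since an even one gives the
    same path. Modulo 2L, and after changing [s] by a multiple of [m], it becomes (s, k). *)
Lemma distinct_ends_frame A C q : ends_of_distinct_maxpaths c q A C ->
  exists d m k s, [/\ apex d, lattice d m k s, apex (move s k d), c d = q &
    A = tail d /\ C = tail (move s k d)].
Proof.
case/and5P=> /imsetP[d1 _ A1] dA /imsetP[e1 _ C1] dC.
have [d td cd] := exists_dart_of_class d1 q; have [e te ce] := exists_dart_of_class e1 q.
rewrite {A}A1 -[porbit _ d1]/(tail d1) -td in dA *.
rewrite {C}C1 -[porbit _ e1]/(tail e1) -te in dC *.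
have hd : apex d by rewrite -degree_apex.
have he : apex e by rewrite -degree_apex.
have [m [k [s hL]]] := exists_lattice hd.
have [x [y eE]] := same_class_move hd (etrans ce (esym cd)).
have hLe : lattice e m k s by rewrite eE; exact: lattice_move.
rewrite -{1}cd -ce (maxpathE hd hL) (maxpathE he hLe) => /eqP neq.
move: (he); rewrite eE => /(lattice_apex _ _ hL hd)[u [v [xE yE]]].
have [w vE] : exists w, v = (2%:Z * w + 1)%R.
  exists (v %/ 2)%Z.
  have [|//] : (v = 2%:Z * (v %/ 2)%Z \/ v = 2%:Z * (v %/ 2)%Z + 1)%R by lia.
  move=> v2; case: neq; rewrite eE (near_edges hd hL) -?eE //.
  by exists (v %/ 2)%Z; rewrite yE {1}v2; ring.
have eE' : e = move (s + u * m%:Z)%R k d.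
  by rewrite eE -[RHS](move_period hL _ _ 0 w) xE yE vE; congr (move _ _ d); ring.
exists d, m, k, (s + u * m%:Z)%R; rewrite -eE'.
split=> //; [exact: lattice_shift|by rewrite class_move|by rewrite eE].
Qed.

(** The ends at (0, 0) and (s, k) lie on different paths, so the default pair never occurs. *)
Lemma chosen_endsP q : ends_of_distinct_maxpaths c q (chosen_ends c q).1 (chosen_ends c q).2.
Proof.
rewrite /chosen_ends; case: pickP => //= no; exfalso.
have [d hd cd] := exists_apex q; have [m [k [s hL]]] := exists_lattice hd.
have he : apex (move s k d) by apply/(lattice_apex _ _ hL hd); exists 0%R, 1%R; lia.
have := no (tail d, tail (move s k d)); rewrite /ends_of_distinct_maxpaths /=.
rewrite !degree_apex hd he !imset_f //= -cd (maxpathE hd hL) -(class_move s k d).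
rewrite (maxpathE he (lattice_move _ _ hL)) (far_edges hd hL he) //.
by case=> w wE; case: hL => _ k_gt0 _; (have [|] : (w <= 0 \/ 1 <= w)%R by lia); nia.
Qed.

(** * Distance between the two maximal paths of a class *)

(** A step has norm x^2 + x y + y^2 = 1, which bounds the change of height by one. *)
Lemma adj_level u v d x y : apex d -> adj u v -> u = tail (move x y d) ->
  exists x' y', v = tail (move x' y' d) /\ (y - 1 <= y' <= y + 1)%R.
Proof.
move=> hd /existsP[f /andP[/eqP <- /eqP <-]] /eqP.
rewrite eq_porbit_mem => /porbitP[i ->].
have [x' [y' [E nrm]]] := move_iter_rot i 1 0 (move x y d).
exists (x' + x)%R, (y' + y)%R; split; last by nia.
by rewrite head_straight straightE E moveD /tail porbit_perm.
Qed.

Lemma path_level u t d x y : apex d -> path (@adj G) u t -> u = tail (move x y d) ->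
  exists x' y', last u t = tail (move x' y' d) /\ (y - (size t)%:Z <= y' <= y + (size t)%:Z)%R.
Proof.
move=> hd; elim: t u x y => [|v t IH] u x y /=.
  by move=> _ ->; exists x, y; split=> //; lia.
case/andP=> uv vt uE; have [x1 [y1 [vE h1]]] := adj_level hd uv uE.
have [x' [y' [-> h]]] := IH _ _ _ vt vE.
by exists x', y'; split=> //; lia.
Qed.

Lemma sideways_path n d : exists t : seq {set dart G},
  [/\ size t = n, path (@adj G) (tail d) t & last (tail d) t = tail (move 0 n d)].
Proof.
elim: n d => [|n IH] d; first by exists [::]; rewrite /= move0.
have [t [st pt lt]] := IH (move 0 1 d).
exists (tail (move 0 1 d) :: t); split=> /=; first by rewrite st.
  rewrite pt andbT; apply/existsP; exists (rot G d); rewrite tail_rot eqxx.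
  by rewrite head_straight straightE move_rot tail_rot eqxx.
by rewrite lt moveD; congr (tail (move _ _ d)); lia.
Qed.

(** The vertices of the other path have odd multiples of [k] as heights, each step changes the
    height by at most one, and [k] steps sideways attain the bound. *)
Lemma distance_parallel d m k s : apex d -> lattice d m k s ->
  distance (verts (tail d) (traject straight d m))
    (verts (tail (move s k d)) (traject straight (move s k d) m)) = k.
Proof.
move=> hd hL; have [m_gt0 k_gt0 h] := hL.
apply: find_iota.
(* [k] lies within the range of the search, as the translates at heights 0, ..., 2 k - 1 are
   distinct darts. *)
- have inj : injective (fun j : 'I_(2 * k) => move 0 j d).
    move=> i j /move_eq/h[u [v [_ E]]]; apply: val_inj => /=.
    have := ltn_ord i; have := ltn_ord j.
    by (have [|[]] : (v = 0 \/ 1 <= v \/ v <= -1)%R by lia); nia.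
  by have := leq_card _ inj; rewrite card_ord; lia.
- have [t [/eqP st pt lt]] := sideways_path k (move s 0 d).
  apply/existsP; exists (tail (move s 0 d)); apply/andP; split.
    by apply/(on_axis hd hL); exists 0%R; lia.
  apply/existsP; exists (Tuple st); rewrite /= pt lt moveD.
  by rewrite add0r addr0 inE eqxx.
move=> n nk; apply/negP => /existsP[u /andP[/mem_verts_traject[i _ uE]]].
case/existsP=> t /andP[pt]; have [x' [y' [-> h1]]] := path_level hd pt uE.
case/mem_verts_traject=> j _; rewrite moveD => /(tail_move _ _ _ _ hd).
rewrite size_tuple in h1.
case=> /h[a [b [_ E]]];
  by (have [|[|[]]] : (b = 0 \/ b = -1 \/ 1 <= b \/ b <= -2)%R by lia); nia.
Qed.

(** * Branches *)

Section BranchPositions.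
Variables (d : dart G) (m k : nat) (s : int).
Hypotheses (hd : apex d) (hL : lattice d m k s).

Let p := traject straight d m.
Let V := verts (tail d) p.

Let sp : size p = m. Proof. exact: size_traject. Qed.

Lemma nth_path e j : j < m -> nth e p j = move j 0 d.
Proof. by move=> jm; rewrite (set_nth_default d) ?sp // nth_traject // iter_straight. Qed.

Lemma index_path j : j <= m -> index (tail (move j 0 d)) V = j.
Proof.
move=> jm; have sV : size V = m.+1 by rewrite /V verts_traject size_map size_traject.
have <- : nth (tail d) V j = tail (move j 0 d).
  by rewrite /V verts_traject (nth_map d) ?size_traject // nth_traject // iter_straight.
by rewrite index_uniq ?sV //; exact: uniq_path_verts hd hL.
Qed.

Lemma move_axis_eq (i j : nat) : move i 0 d = move j 0 d ->
  exists u, (i%:Z - j%:Z = 2%:Z * u * m%:Z)%R.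
Proof. by move/move_eq/(move_axis hd hL). Qed.

Definition branch_value e :=
  let j := index (tail e) V in
  if left_branch p j e then branch_position p j e
  else branch_position p j e - size p.

Lemma tail_far X : m <= X <= 2 * m -> tail (move X 0 d) = tail (move (2 * m - X)%N 0 d).
Proof.
move=> hX; rewrite -tail_half_turn half_turn_move // -(move_period hL _ _ 1 0).
by congr (tail (move _ _ d)); lia.
Qed.

Lemma class_rot_neq e : c (rot G e) <> c e.
Proof. by rewrite class_rot; case: (c e) => [[|[|[|]]]]. Qed.

Lemma class_rot2_neq e : c (rot G (rot G e)) <> c e.
Proof. by rewrite !class_rot; case: (c e) => [[|[|[|]]]]. Qed.

(** On the way out, X < m, the branch is on the left at vertex X; on the way back it is on the right
    at vertex 2 m - X. In both cases [A,q](e) = X. *)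
Lemma branch_value_rot X : X < 2 * m ->
  branch_value (rot G (move X 0 d)) = if X < m then X else X - m.
Proof.
move=> Xm; rewrite /branch_value tail_rot.
have [X_lt|X_ge] := ltnP X m.
  rewrite index_path 1?ltnW // /branch_position.
  have -> // : left_branch p X (rot G (move X 0 d)).
  by rewrite /left_branch sp X_lt nth_path // eqxx.
rewrite tail_far ?X_ge ?(ltnW Xm) // index_path; last lia.
rewrite /branch_position.
have -> : left_branch p (2 * m - X) (rot G (move X 0 d)) = false.
  apply/negbTE/negP => /orP[]; rewrite sp => /andP[jm /eqP].
    rewrite nth_path // => /perm_inj/move_axis_eq[u E].
    by (have [|[]] : (u = 0 \/ 1 <= u \/ u <= -1)%R by lia); nia.
  rewrite nth_path; last lia.
  move/(congr1 c); rewrite class_opp !class_rot !class_move => /esym.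
  by rewrite -!class_rot; exact: class_rot2_neq.
by rewrite sp; lia.
Qed.

(** Here the dart precedes the backward edge instead of following the forward one, so X = m counts
    as left, and the range excludes 0 but includes 2 m. *)
Lemma branch_value_rot2 X : 0 < X <= 2 * m ->
  branch_value (rot G (rot G (move X 0 d))) = if X <= m then X else X - m.
Proof.
case/andP=> X0 Xm; rewrite /branch_value !tail_rot.
have [X_le|X_gt] := leqP X m.
  rewrite index_path // /branch_position.
  have -> // : left_branch p X (rot G (rot G (move X 0 d))).
  rewrite /left_branch sp X0 X_le [nth _ _ X.-1]nth_path; last lia.
  by rewrite opp_path // half_turnE eqxx orbT.
rewrite tail_far ?Xm ?(ltnW X_gt) // index_path; last lia.
rewrite /branch_position.
have -> : left_branch p (2 * m - X) (rot G (rot G (move X 0 d))) = false.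
  apply/negbTE/negP => /orP[]; rewrite sp => /andP[jm /eqP].
    rewrite nth_path // => /perm_inj/(congr1 c); rewrite class_move -(class_move X 0 d).
    exact: class_rot_neq.
  rewrite nth_path; last lia.
  rewrite -half_turnE opp_path; last lia.
  move=> /perm_inj/move_axis_eq[u E].
  by (have [|[]] : (u = 0 \/ 1 <= u \/ u <= -1)%R by lia); nia.
by rewrite sp; lia.
Qed.

(* The path leaving the other axis in the direction of [g] meets the axis of
   [d] after exactly [k] steps. *)
Lemma S_at_first_edge g (x : nat -> int) : apex g -> c g <> c d ->
  (forall j, j <= k -> tail (move j 0 g) = tail (move (x j) (j%:Z - k%:Z)%R d)) ->
  S_at c (c d) (c g) (tail d) (tail g) = branch_value (half_turn (move k 0 g)).
Proof.
move=> hg cgd hx; have [m' [k' [s' hL']]] := exists_lattice hg.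
have k_gt0 : 0 < k by case: hL.
have off j : j < k -> tail (move j 0 g) \notin V.
  move=> jk; rewrite hx ?(ltnW jk) //; apply/negP => /(on_axis hd hL)[w E].
  by (have [|] : (0 <= w \/ w <= -1)%R by lia); nia.
have on : tail (move k 0 g) \in V.
  by rewrite hx //; apply/(on_axis hd hL); exists 0%R; lia.
(* An earlier end would be a vertex of degree 3 at a height strictly between -k and 0, whereas such
   vertices have multiples of [k] as heights. *)
have km : k <= m'.
  rewrite leqNgt; apply/negP => mk; have := apex_path_end hg hL'.
  rewrite -degree_apex hx ?(ltnW mk) // degree_apex => /(lattice_apex _ _ hL hd)[u [v [_ E]]].
  have m'_gt0 : 0 < m' by case: hL'.
  by (have [|] : (0 <= v \/ v <= -1)%R by lia); nia.
rewrite /S_at (maxpathE hd hL) (maxpathE hg hL').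
(* The first k - 1 darts stay off the path; the next one is the first adjacent edge, and its dart at
   the path is its opposite. *)
have -> : m' = k.-1 + (m' - k).+1 by lia.
rewrite trajectD filter_cat iter_straight.
have -> : [seq e <- traject straight g k.-1 | adjacent (tail d) p e] = [::].
  apply/eqP; rewrite -[_ == _]negbK -has_filter; apply/hasPn => e /trajectP[i ik ->].
  rewrite /adjacent iter_straight head_straight straightE moveD.
  rewrite (negbTE (off i _)) ?(negbTE (off i.+1 _)) ?andbF //; lia.
have head_k : head (move k.-1 0 g) = tail (move k 0 g).
  by rewrite head_straight straightE moveD; congr (tail (move _ _ g)); lia.
have tail_k : tail (move k.-1 0 g) \notin V by apply: off; lia.
have adj_k : adjacent (tail d) p (move k.-1 0 g).
  rewrite /adjacent head_k on orbT andbT (mem_edges_path hd hL) class_move.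
  by rewrite (introF eqP cgd).
have opp_k : opp G (move k.-1 0 g) = half_turn (move k 0 g) by rewrite opp_path.
by rewrite /= adj_k /dart_at (negbTE tail_k) opp_k.
Qed.

End BranchPositions.

(** * The parameters of a class in terms of the lattice *)

(** With A at the origin and C at (-s, -k), the paths of classes q + 1 and q - 1 from C reach the
    axis of A at -s and -s - k. By the half-turn about A these are also the positions s and s + k,
    whose residues modulo M are S^+ and S^-. *)
Lemma class_parameters q : exists d, [/\ c d = q, apex d,
  lattice d (M c q) (K c q) (Splus c q), Splus c q < M c q &
  0 < Sminus c q <= M c q /\
  exists w, ((Sminus c q)%:Z = (Splus c q)%:Z + (K c q)%:Z + w * (M c q)%:Z)%R].
Proof.
have [d [m [k [s [hd hL he cd [A_d C_e]]]]]] := distinct_ends_frame (chosen_endsP q).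
set e := move s k d in he C_e; have hLe : lattice e m k s by exact: lattice_move.
have ce : c e = c d by rewrite class_move.
have e_opp : e = move (- s)%R (- k%:Z)%R d by rewrite -half_turn_move // (eqP he).
have maxA : maxpath c (chosen_ends c q).1 q = traject straight d m.
  by rewrite A_d -cd (maxpathE hd hL).
have maxC : maxpath c (chosen_ends c q).2 q = traject straight e m.
  by rewrite C_e -cd -ce (maxpathE he hLe).
have ME : M c q = m by rewrite /M maxA size_traject.
have KE : K c q = k.
  by rewrite /K /maxpath_verts maxA maxC A_d C_e; exact: distance_parallel hd hL.
have [m_gt0 k_gt0 h] := hL.
have [X Xm [XE [u uE]]] := move_axis_mod hd hL s.
have SpE : Splus c q = if X < m then X else X - m.
  rewrite -(branch_value_rot hd hL Xm) -XE.
  have -> : rot G (move s 0 d) = half_turn (move k 0 (rot G e)).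
    rewrite move_rot -rot_half_turn e_opp moveD half_turn_move //.
    by congr (rot G (move _ _ d)); lia.
  rewrite /Splus A_d C_e -cd -ce -class_rot ce -(tail_rot e).
  apply: (S_at_first_edge hd hL (x := fun=> (- s)%R)); rewrite ?apex_rot //.
    by rewrite -ce; exact: class_rot_neq.
  move=> j _; rewrite move_rot tail_rot e_opp moveD.
  by congr (tail (move _ _ d)); lia.
(* [branch_value_rot2] asks for a position in (0, 2 m], so the residue 0 is replaced by 2 m. *)
have [Y [Y0 Ym YE [v vE]]] : exists Y, [/\ 0 < Y, Y <= 2 * m,
    move (s + k%:Z)%R 0 d = move Y 0 d &
    exists v, (Y%:Z = s + k%:Z + 2%:Z * (v * m%:Z))%R].
  have [Y Ym [YE [v vE]]] := move_axis_mod hd hL (s + k%:Z)%R.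
  have [Y0|Y0] := posnP Y; last by exists Y; split=> //; [lia|exists v].
  exists (2 * m); split; [lia|lia| |exists (v + 1)%R; lia].
  by rewrite YE Y0 -(move_period hL _ _ 1 0); congr (move _ _ d); lia.
have SmE : Sminus c q = if Y <= m then Y else Y - m.
  have Y2 : 0 < Y <= 2 * m by rewrite Y0.
  rewrite -(branch_value_rot2 hd hL Y2) -YE.
  have -> : rot G (rot G (move (s + k%:Z)%R 0 d)) =
      half_turn (move k 0 (rot G (rot G e))).
    rewrite !move_rot -!rot_half_turn e_opp moveD half_turn_move //.
    by congr (rot G (rot G (move _ _ d))); lia.
  have c2 : (q - 1)%R = c (rot G (rot G e)).
    rewrite !class_rot ce cd; case: (q) => [[|[|[|]]]] // i; exact: val_inj.
  rewrite /Sminus c2 A_d C_e -[in X in S_at _ X]cd -(tail_rot e) -(tail_rot (rot G e)).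
  apply: (S_at_first_edge hd hL (x := fun j => (- s - j%:Z)%R)); rewrite ?apex_rot //.
    by rewrite -ce; exact: class_rot2_neq.
  move=> j _; rewrite !move_rot !tail_rot e_opp moveD.
  by congr (tail (move _ _ d)); lia.
rewrite ME KE; have SpM : Splus c q < m by rewrite SpE; case: ifP => ?; lia.
have [a aE] : exists a, ((Splus c q)%:Z = s + a * m%:Z)%R.
  by rewrite SpE; case: ifP => ?; [exists (2%:Z * u)%R|exists (2%:Z * u - 1)%R]; lia.
have [b bE] : exists b, ((Sminus c q)%:Z = s + k%:Z + b * m%:Z)%R.
  by rewrite SmE; case: ifP => ?; [exists (2%:Z * v)%R|exists (2%:Z * v - 1)%R]; lia.
exists d; split=> //; first by rewrite aE; exact: lattice_shift.
split; first by rewrite SmE; case: ifP => ?; lia.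
by exists (b - a)%R; rewrite bE aE; ring.
Qed.

(** * Mirror symmetries and the orbit *)

Lemma class_span d : apex d ->
  forall x y, apex (move x y d) <-> span (M c (c d)) (K c (c d)) (Splus c (c d)) x y.
Proof.
have [e [ce he hL _ _]] := class_parameters (c d).
move=> hd x y; exact: lattice_apex (lattice_class he (esym ce) hL) hd.
Qed.

(** Both lattices are the set of vertices of degree 3, in frames that differ by a rotation of 60
    degrees. *)
Lemma span_next_class q x y :
  span (M c (q + 1)%R) (K c (q + 1)%R) (Splus c (q + 1)%R) x y <->
  span (M c q) (K c q) (Splus c q) (- y)%R (x + y)%R.
Proof.
have [d hd <-] := exists_apex q; rewrite -class_rot.
have hr : apex (rot G d) by rewrite apex_rot.
have E : apex (move x y (rot G d)) = apex (move (- y)%R (x + y)%R d).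
  by rewrite move_rot apex_rot.
split=> [/(class_span hr)|/(class_span hd)]; first by rewrite E => /(class_span hd).
by rewrite -E => /(class_span hr).
Qed.

(** The bound S^- <= M makes the subtraction exact; replacing S^- by S^+ + K + w M gives the
    coefficient 1 - w. *)
Lemma mirror_span q : Splus c q = M c q - Sminus c q ->
  exists a, (2%:Z * (Splus c q)%:Z + (K c q)%:Z = a * (M c q)%:Z)%R.
Proof.
by have [_ [_ _ _ _ [h [w hw]]]] := class_parameters q; exists (1 - w)%R; lia.
Qed.

(** With the central symmetry, the two reflections yield invariance under rotation by 60 degrees.
    The lattice then looks the same from all three classes, and uniqueness of the Hermite form
    equates the triples. *)
Lemma adjacent_mirrors q : Splus c q = M c q - Sminus c q ->
  Splus c (q + 1)%R = M c (q + 1)%R - Sminus c (q + 1)%R ->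
  exists k, 0 < k /\ ((forall r, (K c r, M c r, Splus c r) = (k, k, 0)) \/
    (forall r, (K c r, M c r, Splus c r) = (k, 3 * k, k))).
Proof.
move=> /mirror_span[a E] /mirror_span[a' E'].
have rotq := span_rotate E E' (span_next_class q).
have next r : (forall x y, span (M c r) (K c r) (Splus c r) (- y)%R (x + y)%R <->
    span (M c r) (K c r) (Splus c r) x y) ->
  (K c (r + 1)%R, M c (r + 1)%R, Splus c (r + 1)%R) = (K c r, M c r, Splus c r).
  move=> rr; have [_ [_ _ [m0 k0 _] s_lt _]] := class_parameters r.
  have [_ [_ _ [m0' k0' _] s_lt' _]] := class_parameters (r + 1)%R.
  apply: (span_inj m0' k0' m0 k0 s_lt' s_lt) => x y.
  exact: iff_trans (span_next_class r x y) (rr x y).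
have eq1 := next _ rotq.
have [K1 M1 S1] := triple_inj eq1.
have rotq1 x y :
    span (M c (q + 1)%R) (K c (q + 1)%R) (Splus c (q + 1)%R) (- y)%R (x + y)%R <->
    span (M c (q + 1)%R) (K c (q + 1)%R) (Splus c (q + 1)%R) x y.
  by rewrite K1 M1 S1; exact: rotq.
have eq2 := etrans (next _ rotq1) eq1.
have all_eq r : (K c r, M c r, Splus c r) = (K c q, M c q, Splus c q).
  by case: (Z3_cases q r) => [->|[->|->]]; [exact: erefl|exact: eq1|exact: eq2].
have [_ [_ _ [m0 k0 _] s_lt _]] := class_parameters q.
exists (K c q); split; first exact: k0.
case: (span_hexagonal m0 k0 s_lt E (fun x y => (rotq x y).2)) => H; [left|right] => r.
  exact: etrans (all_eq r) H.
exact: etrans (all_eq r) H.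
Qed.

End Translations.

Lemma orbit_of_singleton (G : rotation_system) (c : dart G -> 'Z_3) t :
  orbit_of c =i [:: t] <-> forall q, (K c q, M c q, Splus c q) = t.
Proof.
split=> [h q|h u]; first by apply/eqP; rewrite -mem_seq1 -h map_f ?mem_enum.
rewrite inE; apply/mapP/eqP => [[q _ ->]|->]; first exact: h.
by exists 0%R; rewrite ?mem_enum ?h.
Qed.

Theorem theorem4p2 (G : rotation_system) (c : dart G -> 'Z_3)
  (hG : in_P G) (hc : class_partition c) :
  double_mirror_symmetric c <->
  exists k : nat, 0 < k /\
    (orbit_of c =i [:: (k, k, 0)] \/ orbit_of c =i [:: (k, 3 * k, k)]).
Proof.
split=> [[q1 [q2 [neq h1 h2]]]|[k [k_gt0 h]]].
  have [k [k_gt0 h]] : exists k, 0 < k /\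
      ((forall r, (K c r, M c r, Splus c r) = (k, k, 0)) \/
       (forall r, (K c r, M c r, Splus c r) = (k, 3 * k, k))).
    (* Distinct classes are successive in one of the two orders. *)
    case: (Z3_cases q1 q2) => [E|[E|E]].
    - by rewrite E eqxx in neq.
    - by apply: (adjacent_mirrors hG hc h1); rewrite -E.
    - have E' : q1 = (q2 + 1)%R.
        by rewrite E; case: (q1) => [[|[|[|]]]] // i; apply: val_inj.
      by apply: (adjacent_mirrors hG hc h2); rewrite -E'.
  by exists k; split=> //; case: h => h; [left|right]; apply/orbit_of_singleton.
have mirror q : Splus c q = M c q - Sminus c q.
  have [_ [_ _ _ _ [hS [w hw]]]] := class_parameters hG hc q.
  move: hS hw.
  (* The bounds 0 < S^- <= M turn the congruence into S^- = k, respectively S^- = 2 k. *)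
  case: h => h; have [-> -> ->] := triple_inj ((orbit_of_singleton c _).1 h q) => hS hw.
    have w0 : w = 0%R by nia.
    by rewrite w0 in hw; lia.
  have w0 : w = 0%R by nia.
  by rewrite w0 in hw; lia.
by exists 0%R, 1%R.
Qed.
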